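(* Let $Y$ be a topological vector space, let $A$ be a closed proper subset of $Y$, let $k\in-0^+A\setminus\{0\}$, and assume $k\in-\operatorname{core}0^+A$. Then $\varphi_{A,k}$ is finite-valued and $$\{y\in Y\mid\varphi_{A,k}(y)<t\}=tk+\operatorname{core}A\quad\forall t\in\mathbb{R}.$$ Moreover, $\varphi_{0^+A,k}$ is finite-valued and $$\varphi_{A,k}(y^0)-\varphi_{A,k}(y^1)\le\varphi_{0^+A,k}(y^0-y^1)\quad\forall y^0,y^1\in Y.$$
   Context: Vector spaces are real. ''Proper subset of $Y$'' means nonempty and different from $Y$. $\operatorname{core}$ denotes the algebraic interior. $0^+A=\{u\in Y\mid a+tu\in A\ \forall a\in A,\ \forall t\ge0\}$ is the recession cone. $\nu$ is a symbolic value not in $\overline{\mathbb{R}}=\mathbb{R}\cup\{\pm\infty\}$, and $\inf\emptyset:=\nu$. For $M\subseteq Y$, $\varphi_{M,k}:Y\to\overline{\mathbb{R}}\cup\{\nu\}$ is $\varphi_{M,k}(y)=\inf\{t\in\mathbb{R}\mid y\in tk+M\}$; it is finite-valued if $\varphi_{M,k}(y)\in\mathbb{R}$ for all $y\in Y$. *)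

(* Defs.v *)
From HB Require Import structures.
From mathcomp Require Export all_boot all_order all_algebra.
From mathcomp Require Export boolp classical_sets reals ereal topology tvs.
From mathcomp Require Export num_topology.

Set Implicit Arguments.
Unset Strict Implicit.
Unset Printing Implicit Defensive.

Export Order.TTheory GRing.Theory Num.Theory.
Export numFieldTopology.Exports.

Local Open Scope classical_set_scope.
Local Open Scope ring_scope.

Section Sets.
Context {R : realType} {Y : lmodType R}.
Implicit Types A : set Y.

Definition proper_subset A : Prop := A !=set0 /\ A <> setT.

(* One-sided steps suffice for the algebraic interior, since [y] and [- y]
   are both admissible directions. *)
Definition core A : set Y :=
  [set a | A a /\ forall y : Y, exists2 e : R, 0 < e &
    forall s : R, 0 <= s <= e -> A (a + s *: y)].

Definition recession_cone A : set Y :=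
  [set u | forall a : Y, A a -> forall t : R, 0 <= t -> A (a + t *: u)].

End Sets.

Section Functional.
Context {R : realType}.

(* [None] is the symbolic value nu, distinct from every extended real. *)
Definition inf_nu (S : set R) : option (\bar R) :=
  if `[< S = set0 >] then None else Some (ereal_inf [set t%:E | t in S]).

(* No inequality holds at nu. *)
Definition lt_nu (v : option (\bar R)) (t : R) : bool :=
  if v is Some x then (x < t%:E)%E else false.

(* Meaningful only when [v] is a real number; nu and both infinities are
   sent to the junk value 0. *)
Definition fine_nu (v : option (\bar R)) : R :=
  if v is Some x then fine x else 0.

Definition finite_valued {T : Type} (f : T -> option (\bar R)) : Prop :=
  forall y, exists r : R, f y = Some r%:E.

Definition phi {Y : lmodType R} (M : set Y) (k y : Y) : option (\bar R) :=
  inf_nu [set t : R | y \in [set t *: k + m | m in M]].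

End Functional.

(* Main.v *)
Require Import Defs.

Local Open Scope classical_set_scope.
Local Open Scope ring_scope.

(** Write [C] for the recession cone of [A]. Everything rests on one
    consequence of [- k] lying in the algebraic interior of the cone [C]:
    going far enough along [- k] brings every vector into [C]
    ([core_cone_absorbs]). Since [A + C] is contained in [A], this gives

    - for [a] in [A], the line [y - t *: k] reaches [A], because it reaches
      [a + C];
    - if that line were in [A] for arbitrarily small [t], then every [z] would
      lie in [(y - t *: k) + C] for some such [t], so [A] would be the whole
      space.

    Hence the infimum defining [phi A k y] is over a nonempty set which is
    bounded below ([finite_valued_phi]). Next, [phi A k y < t] means that
    [y - s *: k] is in [A] for some [s < t] ([lt_phiP]). This is equivalent to
    [y - t *: k] being in the core of [A]: the step from [s] to [t] is a
    positive multiple of an interior direction of [C], and conversely a core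
    point can be moved slightly along [k] inside [A] ([core_lineP]).

    The cone [C] is itself a proper subset that recedes along its own elements,
    so finiteness applies to it as well. The last inequality is then the
    inclusion of [A + C] in [A], read on the infima. *)

Section Sublevels.
Set Implicit Arguments.
Unset Strict Implicit.
Unset Printing Implicit Defensive.
Context {R : realType} {Y : lmodType R}.
Implicit Types (A M : set Y) (k y z : Y) (s t : R).

Lemma recession_coneD A a u : A a -> recession_cone A u -> A (a + u).
Proof. by move=> Aa /(_ _ Aa 1 ler01); rewrite scale1r. Qed.

Lemma recession_coneZ A u t :
  0 <= t -> recession_cone A u -> recession_cone A (t *: u).
Proof.
by move=> t0 Cu a Aa s s0; rewrite scalerA; apply: Cu => //; exact: mulr_ge0.
Qed.

(** A recession cone is closed under addition and nonnegative scaling, hence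
    recedes along each of its own elements. *)
Lemma recession_cone_idem A :
  recession_cone A `<=` recession_cone (recession_cone A).
Proof.
move=> u Cu v Cv t t0 a Aa s s0; rewrite scalerDr addrA.
apply: recession_coneD; first exact: Cv.
by apply: recession_coneZ => //; exact: recession_coneZ.
Qed.

Lemma proper_recession_cone A :
  proper_subset A -> proper_subset (recession_cone A).
Proof.
move=> [[a Aa] AT]; split; first by exists 0 => b Ab t _; rewrite scaler0 addr0.
move=> CT; apply: AT; apply/seteqP; split=> // z _.
rewrite -(subrKC a z); apply: recession_coneD => //.
by rewrite CT.
Qed.

Lemma core_sub A : core A `<=` A. Proof. by move=> a []. Qed.

Lemma coreS A B : A `<=` B -> core A `<=` core B.
Proof.
move=> AB a [/AB Ba cAa]; split=> // y.
by have [e e0 eA] := cAa y; exists e => // s /eA /AB.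
Qed.

(** Interiority gives [- k + e *: z] in the cone for some [e > 0]; dividing by
    [e] turns the small perturbation into the arbitrary vector [z]. *)
Lemma core_cone_absorbs A k z : core (recession_cone A) (- k) ->
  exists t, recession_cone A (z - t *: k).
Proof.
move=> [_ /(_ z)[e e0 eC]]; exists e^-1.
have := eC e; rewrite lexx (ltW e0) => /(_ isT) Ce.
have -> : z - e^-1 *: k = e^-1 *: (- k + e *: z).
  by rewrite scalerDr scalerA mulVf ?gt_eqF// scale1r scalerN addrC.
by apply: recession_coneZ => //; rewrite invr_ge0 ltW.
Qed.

Lemma mem_translateE M k y t :
  (y \in [set t *: k + m | m in M]) = (y - t *: k \in M).
Proof.
apply/idP/idP; rewrite !inE; first by case=> m Mm <-; rewrite addrC addKr.
by move=> My; exists (y - t *: k) => //; rewrite subrKC.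
Qed.

(** This holds whether the infimum is nu, infinite or finite, so it can be used
    to prove finiteness as well as to exploit it. *)
Lemma lt_phiP M k y t :
  lt_nu (phi M k y) t <-> exists2 s, s < t & M (y - s *: k).
Proof.
rewrite /phi /inf_nu; case: asboolP => [S0|_]; split => //=.
- move=> [s _ Ms].
  have : [set t | y \in [set t *: k + m | m in M]] s.
    by rewrite /= mem_translateE inE.
  by rewrite S0.
- move=> /ereal_inf_lt[_ [s Ss <-]]; rewrite lte_fin => st; exists s => //.
  by move: Ss; rewrite /= mem_translateE inE.
- move=> [s st Ms]; apply: (@le_lt_trans _ _ s%:E); last by rewrite lte_fin.
  by apply: ereal_inf_lbound; exists s => //=; rewrite mem_translateE inE.
Qed.

Lemma finite_nuP (v : option (\bar R)) t0 t1 :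
  ~~ lt_nu v t0 -> lt_nu v t1 -> exists r : R, v = Some r%:E.
Proof.
case: v => [[r| |]|] /=; first by exists r.
- by rewrite ltNge leey.
- by rewrite ltNyr.
- by [].
Qed.

Lemma lt_fine_phiP M k y t : finite_valued (phi M k) ->
  fine_nu (phi M k y) < t <-> exists2 s, s < t & M (y - s *: k).
Proof.
by move=> /(_ y)[r phiE]; rewrite -lt_phiP phiE /= lte_fin.
Qed.

Lemma finite_valued_phi A k : proper_subset A ->
  core (recession_cone A) (- k) -> finite_valued (phi A k).
Proof.
move=> [[a Aa] AT] kC y.
have [t1 yt1] : exists t, lt_nu (phi A k y) t.
  have [t Ct] := core_cone_absorbs (y - a) kC.
  exists (t + 1); apply/lt_phiP; exists t; first by rewrite ltrDl.
  by rewrite -(subrKC a y) -addrA; exact: recession_coneD.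
have [t0 yt0] : exists t, ~~ lt_nu (phi A k y) t.
  apply: contrapT => /forallNP yt; apply: AT; apply/seteqP; split=> // z _.
  have [t Ct] := core_cone_absorbs (z - y) kC.
  have /negP := yt (- t); rewrite negbK => /lt_phiP[s st As].
  (* The absorbing step overshoots [z] by the multiple [s + t < 0] of [k]; the
     difference is again a nonnegative multiple of the receding [- k]. *)
  have -> : z = y - s *: k + (z - y - t *: k) + (- (s + t)) *: - k.
    rewrite scalerN scaleNr opprK [y - _ + _]addrACA subrKC -opprD.
    by rewrite -scalerDl subrK.
  apply: (core_sub kC) => //; first exact: recession_coneD.
  by rewrite oppr_ge0 -(opprK t) subr_le0 ltW.
exact: finite_nuP yt0 yt1.
Qed.

(** Stepping from a point of [A] along an interior direction of the recession
    cone lands in the core; stepping back from a core point by a small enough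
    amount stays in [A]. *)
Lemma core_lineP A k y t : core (recession_cone A) (- k) ->
  core A (y - t *: k) <-> exists2 s, s < t & A (y - s *: k).
Proof.
move=> kC; split=> [[_ /(_ k)[e e0 eA]]|[s st As]].
  exists (t - e); first by rewrite ltrBlDr ltrDl.
  rewrite scalerBl opprB (addrC (e *: k)) addrA.
  by apply: eA; rewrite lexx ltW.
have st0 : 0 < t - s by rewrite subr_gt0.
have -> : y - t *: k = y - s *: k + (t - s) *: - k.
  by rewrite scalerN scalerBl opprB addrA subrK.
split; first by apply: (core_sub kC) => //; exact: ltW.
move=> d; have [e e0 eC] := kC.2 d; exists ((t - s) * e); first exact: mulr_gt0.
move=> r /andP[r0 re].
have -> : r *: d = (t - s) *: ((r / (t - s)) *: d).
  by rewrite scalerA mulrC divfK// gt_eqF.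
rewrite -addrA -scalerDr; apply: (eC (r / (t - s))) => //; last exact: ltW.
by rewrite divr_ge0 ?(ltW st0)//= ler_pdivrMr// mulrC.
Qed.

Lemma phi_sublevelE A k t : core (recession_cone A) (- k) ->
  [set y | lt_nu (phi A k y) t] = [set t *: k + a | a in core A].
Proof.
move=> kC; apply/seteqP; split=> [y /= /lt_phiP /(core_lineP _ _ kC) cy|].
  by exists (y - t *: k) => //; rewrite subrKC.
move=> _ [a ca <-] /=; apply/lt_phiP/(core_lineP _ _ kC).
by rewrite addrC addKr.
Qed.

Lemma phi_subadd A k y0 y1 : finite_valued (phi A k) ->
  finite_valued (phi (recession_cone A) k) ->
  fine_nu (phi A k y0) - fine_nu (phi A k y1)
    <= fine_nu (phi (recession_cone A) k (y0 - y1)).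
Proof.
move=> finA finC; rewrite lerBlDl; apply/ler_addgt0Pr => e e0.
have e2 : 0 < e / 2 by rewrite divr_gt0.
have /(lt_fine_phiP _ _ finA)[s1 s1e As1] :
  fine_nu (phi A k y1) < fine_nu (phi A k y1) + e / 2 by rewrite ltrDl.
have /(lt_fine_phiP _ _ finC)[s2 s2e Cs2] :
  fine_nu (phi (recession_cone A) k (y0 - y1)) <
  fine_nu (phi (recession_cone A) k (y0 - y1)) + e / 2 by rewrite ltrDl.
apply/ltW/(lt_fine_phiP _ _ finA); exists (s1 + s2).
  by rewrite [e in ltRHS]splitr addrACA ltrD.
have -> : y0 - (s1 + s2) *: k = y1 - s1 *: k + (y0 - y1 - s2 *: k).
  by rewrite addrACA subrKC -opprD scalerDl.
exact: recession_coneD.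
Qed.

End Sublevels.

Theorem proposition8 (R : realType) (Y : topologicalLmodType R)
    (A : set Y) (k : Y)
    (A_closed : closed A) (A_proper : proper_subset A)
    (k_rec : k \in [set - u | u in recession_cone A] `\ 0)
    (k_core : k \in [set - u | u in core (recession_cone A)]) :
  [/\ finite_valued (phi A k),
      forall t : R,
        [set y | lt_nu (phi A k y) t] = [set t *: k + a | a in core A],
      finite_valued (phi (recession_cone A) k) &
      forall y0 y1 : Y,
        fine_nu (phi A k y0) - fine_nu (phi A k y1)
          <= fine_nu (phi (recession_cone A) k (y0 - y1))].
Proof.
have kC : core (recession_cone A) (- k).
  by move: k_core; rewrite inE => -[u Cu <-]; rewrite opprK.
have finA := finite_valued_phi A_proper kC.
have finC : finite_valued (phi (recession_cone A) k).
  apply: finite_valued_phi; first exact: proper_recession_cone.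
  exact: coreS (@recession_cone_idem _ _ A) _ kC.
split=> // [t|y0 y1]; [exact: phi_sublevelE | exact: phi_subadd].
Qed.
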